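(* Let $A,B\in M_{d}^{+}$, $X\in M_{d}$, let $|||\cdot|||$ be any unitarily invariant norm on $M_d$, and let $N$ be a nonnegative integer. If $t>0$ and $0\leq v\leq1$, then $$|||\,|A^{1-v}XB^{v}|^{t}|||\cdot|||\,|A^{v}XB^{1-v}|^{t}|||\ \leq\ |||\,|AX|^{t}|||\cdot|||\,|XB|^{t}|||-\sum_{n=0}^{N-1}r_{n}(v)\sum_{k=1}^{2^{n}}\Delta_{f}(n,k)\,\chi_{\left(\frac{k-1}{2^{n}},\frac{k}{2^{n}}\right)}(v),$$ where $f(u)=|||\,|A^{1-u}XB^{u}|^{t}|||\cdot|||\,|A^{u}XB^{1-u}|^{t}|||$ for $u\in[0,1]$.
   Context: $M_d$ is the set of $d\times d$ complex matrices and $M_d^+$ the subset of positive definite ones. For $Y\in M_d$, $|Y|=(Y^*Y)^{1/2}$. The functions $r_n:[0,1]\to\mathbb{R}$ are defined recursively by $r_0(v)=\min\{v,1-v\}$ and $r_n(v)=\min\{2r_{n-1}(v),1-2r_{n-1}(v)\}$ for $n\ge 1$. For a function $f$ on $[0,1]$, $\Delta_f(n,k)=f\left(\frac{k-1}{2^n}\right)+f\left(\frac{k}{2^n}\right)-2f\left(\frac{2k-1}{2^{n+1}}\right)$. $\chi_I$ is the characteristic function of the interval $I$. A sum $\sum_{n=0}^{N-1}$ is zero when $N=0$. *)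

(* Defs.v *)
From HB Require Import structures.
From mathcomp Require Import all_boot all_order all_algebra.
From mathcomp Require Import all_classical all_reals all_analysis.
From mathcomp Require Import complex.

Set Implicit Arguments.
Unset Strict Implicit.
Unset Printing Implicit Defensive.

Import Order.TTheory GRing.Theory Num.Theory.

Local Open Scope ring_scope.
Local Open Scope complex_scope.
Local Open Scope sesquilinear_scope.

(* The order of R[i] makes [0 < z] say that z is real and positive. *)
Definition posdefmx (R : realType) (d : nat) (A : 'M[R[i]]_d) : Prop :=
  A \is hermsymmx /\
  forall x : 'cV[R[i]]_d, x != 0 -> 0 < (x ^t* *m A *m x) 0 0.

(* Spectral calculus phi(A) for Hermitian A (junk value otherwise): the
   decomposition A = U^* diag(s) U is the one of [orthomx_spectralP], and s is
   real for Hermitian A, so taking real parts loses nothing. *)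
Definition mxfun (R : realType) (d : nat) (phi : R -> R) (A : 'M[R[i]]_d) :
    'M[R[i]]_d :=
  (spectralmx A) ^t* *m
  diag_mx (map_mx (fun z => (phi (complex.Re z))%:C) (spectral_diag A)) *m
  spectralmx A.

(* Real power A^p. Since [powR 0 0 = 1], A^0 is the identity matrix. *)
Definition mxpowR (R : realType) (d : nat) (A : 'M[R[i]]_d) (p : R) :
    'M[R[i]]_d :=
  mxfun (fun x => powR x p) A.

Definition mxabs (R : realType) (d : nat) (Y : 'M[R[i]]_d) : 'M[R[i]]_d :=
  mxpowR (Y ^t* *m Y) 2^-1.

Record unitarily_invariant_norm (R : realType) (d : nat)
    (nrm : 'M[R[i]]_d -> R) : Prop := UnitarilyInvariantNorm {
  uinorm_ge0 : forall Y, 0 <= nrm Y ;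
  uinorm_eq0 : forall Y, nrm Y = 0 -> Y = 0 ;
  uinormZ : forall (a : R[i]) Y, nrm (a *: Y) = complex.Re `|a| * nrm Y ;
  uinormD : forall Y Z, nrm (Y + Z) <= nrm Y + nrm Z ;
  uinormU : forall U Y V, U \is unitarymx -> V \is unitarymx ->
    nrm (U *m Y *m V) = nrm Y
}.

Fixpoint r_ (R : realType) (n : nat) (v : R) : R :=
  if n is m.+1 then Num.min (2 * r_ m v) (1 - 2 * r_ m v)
  else Num.min v (1 - v).

Definition Delta (R : realType) (f : R -> R) (n k : nat) : R :=
  f ((k%:R - 1) / 2 ^+ n) + f (k%:R / 2 ^+ n)
  - 2 * f ((2 * k%:R - 1) / 2 ^+ n.+1).

(* Main.v *)
Require Import Defs.
From mathcomp Require Import all_boot all_order all_algebra.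
From mathcomp Require Import fingroup perm.
From mathcomp Require Import all_classical all_reals all_analysis.
From mathcomp Require Import complex.
From mathcomp Require Import ring lra.

(** Write [g u] for the norm of [|A^(1-u) X B^u|^t], so that
    [f u = g u * g (1 - u)] and [f 0 = f 1] is the leading term of the bound.

    Convexity is all the inequality needs.  If a function lies below its chords
    on [0,1], its chord from 0 to 1 minus the first N generations of second
    differences is its piecewise linear interpolation on the dyadic points of
    level N, and that still lies above the function.  Halving the interval
    turns generation [n+1] into generation [n] of the rescaled function, on
    either half, and this gives an induction ([dyadic_refinement]).

    Convexity of [f] follows from midpoint convexity and boundedness
    ([midconvex_below_chords]), which avoids proving continuity of matrix
    powers.  Midpoint convexity of [f] follows in turn from
    [g ((x + y) / 2) ^+ 2 <= g x * g y] ([uinorm_heinz_log_midconvex]) and the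
    arithmetic-geometric mean inequality ([log_midconvex_below_chords]).

    For that inequality let K, L, M be the matrices [A^(1-u) X B^u] at x, at y
    and at the midpoint.  Then [K^* L] is similar to [M^* M]
    ([gram_similarity]).  On the image S of the top k eigenvectors of [M^* M]
    the matrix [K^* L] thus acts with determinant the product of the k largest
    eigenvalues of [M^* M].  The Cauchy-Schwarz inequality for determinants of
    Gram type ([det_CauchySchwarz]) bounds it by the volumes of [K S] and
    [L S], hence by the k largest singular values of K and L ([det_gram_le]);
    both facts come from the Cauchy-Binet formula.  The singular values of M are
    therefore weakly log-majorized by the geometric means of those of K and L
    ([log_majorization_of_similar]).

    A unitarily invariant norm evaluated on diagonal matrices is symmetric,
    convex and monotone.  Such a function respects weak log-majorization
    ([weak_log_majorization], [uinorm_log_majorization]) and satisfies a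
    Cauchy-Schwarz inequality ([uinorm_diag_CauchySchwarz]); together with the
    previous paragraph this gives the midpoint inequality for [g]. *)

Set Implicit Arguments.
Unset Strict Implicit.
Unset Printing Implicit Defensive.

Import Order.TTheory GRing.Theory Num.Theory.

Local Open Scope ring_scope.
Local Open Scope complex_scope.
Local Open Scope sesquilinear_scope.

(** * Weak log-majorization of sequences *)

Lemma nth_ge0 (R : realDomainType) (s : seq R) i : all (>= 0) s -> 0 <= s`_i.
Proof.
move=> s0; have [hi|hi] := ltnP i (size s); last by rewrite nth_default.
exact/(allP s0)/mem_nth.
Qed.

Lemma nth_decr (R : realDomainType) (s : seq R) i j :
  sorted >=%R s -> all (>= 0) s -> (i <= j)%N -> s`_j <= s`_i.
Proof.
move=> ss s0 ij; have [jn|jn] := ltnP j (size s).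
  apply: (sorted_leq_nth ge_trans (@lexx _ _)) => //.
  exact: leq_ltn_trans jn.
rewrite nth_default//; have [hi|hi] := ltnP i (size s); last by rewrite nth_default.
exact/(allP s0)/mem_nth.
Qed.

Lemma sorted_mkseq (R : realDomainType) (u : nat -> R) d :
  (forall i j, (i <= j)%N -> u j <= u i) -> sorted >=%R (mkseq u d).
Proof. by move=> hu; apply: (homo_sorted (e := leq)) (iota_sorted 0 d) => i j /hu. Qed.

Lemma prod_take (T : comNzRingType) k (s : seq T) : (k <= size s)%N ->
  \prod_(x <- take k s) x = \prod_(i < k) s`_i.
Proof.
move=> ks; rewrite (big_nth 0) size_takel// big_mkord.
by apply: eq_bigr => i _; rewrite nth_take.
Qed.

Lemma prod_powR (R : realType) k (u : nat -> R) (r : R) : (forall i, 0 <= u i) ->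
  \prod_(i < k) powR (u i) r = powR (\prod_(i < k) u i) r.
Proof.
move=> u0; elim: k => [|k IHk]; first by rewrite !big_ord0 powR1.
by rewrite !big_ord_recr /= IHk powRM// prodr_ge0.
Qed.

Lemma ler_prod_pivot (R : realDomainType) (z : R) (s s' : seq R) :
  size s = size s' -> 0 <= z -> all (>= 0) s ->
  (forall x, x \in s -> x <= z) -> (forall x, x \in s' -> z <= x) ->
  \prod_(x <- s) x <= \prod_(x <- s') x.
Proof.
move=> + z0; elim: s s' => [|x s IHs] [|x' s']//=.
move=> [szs] /andP[x0 s0] hs hs'; rewrite !big_cons.
apply: ler_pM => //.
- by rewrite big_seq prodr_ge0// => y ys; exact: (allP s0).
- by apply: (@le_trans _ _ z); [apply: hs|apply: hs']; rewrite mem_head.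
- apply: IHs => // y ys; [apply: hs|apply: hs']; by rewrite inE ys orbT.
Qed.

(** The factors shared with the initial segment cancel.  The remaining ones,
    equally many on both sides, are separated by the pivot [s`_k]. *)
Lemma prod_inj_le (R : realDomainType) k d (s : seq R) (f : 'I_k -> 'I_d) :
  size s = d -> sorted >=%R s -> all (>= 0) s -> injective f ->
  \prod_i s`_(f i) <= \prod_(x <- take k s) x.
Proof.
move=> ssz ss s0 finj.
have kd : (k <= d)%N by rewrite -[k]card_ord -[d]card_ord (leq_card f finj).
pose J := f @: [set: 'I_k]; pose K := [set i : 'I_d | (i < k)%N].
have ps (i : nat) : 0 <= s`_i by exact: nth_ge0.
have -> : \prod_i s`_(f i) = \prod_(j in J) s`_j.
  by rewrite big_imset /=; [apply: eq_bigl => i; rewrite inE|move=> x y _ _ /finj].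
have -> : \prod_(x <- take k s) x = \prod_(j in K) s`_j.
  rewrite prod_take ?ssz// (big_ord_widen _ (fun i => s`_i) kd).
  by apply: eq_bigl => i; rewrite inE.
have cJK : #|J| = #|K|.
  rewrite card_imset// cardsT card_ord.
  have -> : K = (widen_ord kd) @: [set: 'I_k].
    apply/setP => i; rewrite inE; apply/idP/imsetP => [ik|[j _ ->]].
      by exists (Ordinal ik) => //; apply: val_inj.
    exact: (ltn_ord j).
  by rewrite card_imset ?cardsT ?card_ord// => x y [] /val_inj.
rewrite (big_setID K) [leRHS](big_setID J) /= finset.setIC ler_wpM2l//.
  by apply: prodr_ge0.
have listE (A : {set 'I_d}) :
    \prod_(j in A) s`_j = \prod_(x <- [seq s`_(nat_of_ord j) | j <- enum A]) x.
  by rewrite big_map big_enum.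
rewrite !listE; apply: (@ler_prod_pivot _ s`_k) => //.
- by rewrite !size_map -!cardE !cardsD finset.setIC cJK.
- by apply/allP => _ /mapP[j _ ->].
- move=> x /mapP[j]; rewrite mem_enum !inE -leqNgt => /andP[kj _] ->.
  exact: nth_decr.
- move=> x /mapP[j]; rewrite mem_enum !inE => /andP[_ jk] ->.
  by apply: nth_decr => //; exact: ltnW.
Qed.

Lemma perm_pull2 (T : eqType) (c b1 b2 : seq T) (x y : T) :
  perm_eq (c ++ x :: b1 ++ y :: b2) [:: x, y & c ++ b1 ++ b2].
Proof.
apply/seq.permP => P; rewrite !count_cat /= !count_cat /=.
rewrite [(count P b1 + (_ + _))%N]addnCA addnCA; congr addn.
by rewrite addnCA.
Qed.

(** Weak log-majorization is generated by exchanges of two entries and by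
    decreasing entries.  To peel
    off the largest entry [a0] of [a], take the consecutive entries
    [p >= a0 > q] of [b] and replace them by [a0] and [p * q / a0].  The product
    is kept, the sum does not grow because [(p - a0) * (a0 - q) >= 0], so [F]
    does not grow either; removing [a0] on both sides preserves the hypotheses.
    Working with [p * q / a0] makes vanishing entries harmless.  The common part
    [c] collects the entries already matched. *)
Lemma weak_log_majorization (R : realType) (F : seq R -> R) (d : nat) :
  (forall s s', perm_eq s s' -> F s = F s') ->
  (forall s s', size s = d -> size s' = d ->
     (forall i, 0 <= s`_i <= s'`_i) -> F s <= F s') ->
  (forall (p q x y : R) (s : seq R), (size s).+2 = d -> all (>= 0) s ->
     0 <= q -> q <= x <= p -> 0 <= y <= p + q - x ->
     F [:: x, y & s] <= F [:: p, q & s]) ->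
  forall c a b : seq R, size a = size b -> (size c + size a)%N = d ->
    sorted >=%R a -> sorted >=%R b ->
    all (>= 0) c -> all (>= 0) a -> all (>= 0) b ->
    (forall k, \prod_(x <- take k a) x <= \prod_(x <- take k b) x) ->
    F (c ++ a) <= F (c ++ b).
Proof.
move=> Fperm Fmono Fexch c a.
elim: a c => [|a0 a IHa] c b szab szd sa sb c0 pa pb hk.
  by case: b szab {sb pb hk}.
have a0max x : x \in a -> x <= a0.
  by move=> xa; move: sa => /= /(order_path_min ge_trans)/allP/(_ _ xa).
have dominated : (forall x, x \in b -> a0 <= x) -> F (c ++ a0 :: a) <= F (c ++ b).
  move=> hb; apply: Fmono; rewrite ?size_cat -?szab// => i.
  rewrite !nth_cat; case: ifP => hi; first by rewrite lexx nth_ge0.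
  rewrite nth_ge0//=.
  have [hj|hj] := ltnP (i - size c) (size b); last first.
    by rewrite !nth_default// szab.
  apply: (@le_trans _ _ a0); last exact/hb/mem_nth.
  have := mem_nth 0 (s := a0 :: a); rewrite szab => /(_ _ hj).
  by rewrite inE => /predU1P[->//|/a0max].
have [a0z|a0nz] := eqVneq a0 0.
  by apply: dominated => x xb; rewrite a0z; exact: (allP pb).
have a0p : 0 < a0 by rewrite lt_neqAle eq_sym a0nz; case/andP: pa.
have [hasb|/hasPn nolt] := boolP (has (< a0) b); last first.
  by apply: dominated => x /nolt; rewrite -leNgt.
have pos_a : all (>= 0) a by case/andP: pa.
have sorted_a : sorted >=%R a by apply: path_sorted sa.
(* [q] is the first entry of [b] below [a0]; the prefix of length one shows
   that it is not the head of [b], so it has a predecessor [p]. *)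
have [q [b1 [b2 [defb qlt b1ge]]]] : exists q b1 b2,
    [/\ b = b1 ++ q :: b2, q < a0 & forall x, x \in b1 -> a0 <= x].
  exists b`_(find (< a0) b), (take (find (< a0) b) b), (drop (find (< a0) b).+1 b).
  split; last 2 first.
  - exact: (nth_find 0 hasb).
  - move=> x xb; have := before_find 0 (a := (< a0)) (s := b).
    case/(nthP (0 : R)): xb => i; rewrite size_takel ?find_size// => hi <- /(_ i hi).
    by rewrite nth_take// => /= /negbT; rewrite -leNgt.
  by rewrite -drop_nth ?cat_take_drop// -has_find.
case/lastP: b1 => [|b1 p] in defb b1ge *.
  have := hk 1%N; rewrite defb /= !take0 !big_seq1.
  by rewrite leNgt qlt.
rewrite cat_rcons in defb.
have pge : a0 <= p by apply: b1ge; rewrite mem_rcons mem_head.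
pose y := p * q / a0.
have q0 : 0 <= q by apply: (allP pb); rewrite defb mem_cat !inE eqxx !orbT.
have qy : q <= y by rewrite ler_pdivlMr// mulrC ler_wpM2r.
have yp : y <= p by rewrite ler_pdivrMr// ler_wpM2l ?(le_trans (ltW a0p))// ltW.
have ysum : y <= p + q - a0 by rewrite ler_pdivrMr//; nra.
have y0 : 0 <= y by apply: le_trans qy.
apply: (@le_trans _ _ (F (rcons c a0 ++ b1 ++ y :: b2))).
  rewrite -cat_rcons; apply: IHa => //.
  - by move: szab; rewrite defb !size_cat/= !addnS => -[].
  - by rewrite size_rcons addSnnS.
  - move: sb; rewrite defb !(sorted_pairwise ge_trans) !pairwise_cat !allrel_consr /=.
    move=> /and3P[/and3P[b1p b1q ->] -> /and3P[/andP[_ pb2] qb2 ->]].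
    rewrite !andbT /=; apply/andP; split.
      by apply: sub_all b1p => z /= /(le_trans yp).
    by apply: sub_all qb2 => z /= /le_trans; apply.
  - by rewrite all_rcons ltW.
  - by move: pb; rewrite defb !all_cat /= y0 => /and4P[-> _ _ ->].
  move=> k; have [hkb|hkb] := leqP k (size b1).
    (* Before the exchange position, [a0] separates the entries of [a] from
       those of [b1]. *)
    have sza : (k <= size a)%N.
      apply: leq_trans hkb _; move: szab; rewrite defb size_cat/= !addnS => -[->].
      by rewrite -addSn leqW// leq_addr.
    apply: (@ler_prod_pivot _ a0); rewrite ?(ltW a0p)//.
    - by rewrite !size_takel// size_cat (leq_trans hkb)// leq_addr.
    - by apply/allP => x /mem_take; exact: (allP pos_a).
    - by move=> x /mem_take/a0max.
    - move=> x; rewrite takel_cat// => /mem_take xb1.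
      by apply: b1ge; rewrite mem_rcons inE xb1 orbT.
  (* Beyond it, [a0 * y = p * q] gives back the prefix product of [b]. *)
  rewrite -(ler_pM2l a0p).
  have := hk k.+1; rewrite defb /= big_cons => /le_trans; apply.
  rewrite [take k _]take_cat [take k.+1 _]take_cat.
  have -> : (k < size b1)%N = false by rewrite ltnNge ltnW.
  have -> : (k.+1 < size b1)%N = false by rewrite ltnNge ltnW// leqW.
  rewrite /= subSn 1?ltnW//; case: (k - size b1)%N (subn_gt0 (size b1) k).
    by rewrite hkb.
  move=> m _ /=; rewrite !big_cat !big_cons /= le_eqVlt; apply/orP; left; apply/eqP.
  by rewrite /y; field.
rewrite (Fperm _ [:: a0, y & c ++ b1 ++ b2]); last first.
  by rewrite cat_rcons perm_pull2.
rewrite (Fperm (c ++ b) [:: p, q & c ++ b1 ++ b2]); last first.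
  rewrite defb catA (perm_trans (perm_pull2 (c ++ b1) [::] b2 p q))//.
  by rewrite /= catA.
apply: Fexch; rewrite ?y0//.
- by rewrite -szd szab defb !size_cat/= !addnS.
- by move: pb; rewrite defb !all_cat c0 /= => /and4P[-> _ _ ->].
- by rewrite pge ltW.
Qed.

(** * The Cauchy-Binet formula and inequalities between Gram determinants *)

(** This is multilinearity of the determinant in the rows of [A *m B]. *)
Lemma det_mulmx_sum (T : comNzRingType) k d (A : 'M[T]_(k, d)) (B : 'M[T]_(d, k)) :
  \det (A *m B) =
  \sum_(f : {ffun 'I_k -> 'I_d}) (\prod_i A i (f i)) * \det (rowsub f B).
Proof.
under eq_bigr do rewrite /determinant big_distrr /=.
rewrite exchange_big; apply: eq_bigr => s _ /=.
under eq_bigr => i _ do rewrite mxE.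
rewrite bigA_distr_bigA big_distrr /=; apply: eq_bigr => f _.
rewrite mulrCA; congr (_ * _); rewrite -big_split /=.
by apply: eq_bigr => i _; rewrite !mxE.
Qed.

(** Summing over all maps instead of k-subsets costs the factor [k`!]: maps
    that are not injective contribute nothing, and each k-subset is the image
    of [k`!] injective ones.  No enumeration of subsets is then necessary. *)
Lemma Cauchy_Binet (T : comNzRingType) k d (A : 'M[T]_(k, d)) (B : 'M[T]_(d, k)) :
  (k`!)%:R * \det (A *m B) =
  \sum_(f : {ffun 'I_k -> 'I_d}) \det (colsub f A) * \det (rowsub f B).
Proof.
transitivity (\sum_(s : 'S_k) \det (A *m B)).
  by rewrite sumr_const card_Sn mulr_natl.
under [RHS]eq_bigr => f _ do rewrite {1}/determinant big_distrl /=.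
rewrite [RHS]exchange_big; apply: eq_bigr => s _ /=.
rewrite det_mulmx_sum.
rewrite (reindex (fun f : {ffun 'I_k -> 'I_d} => [ffun i => f (s i)])) /=; last first.
  exists (fun f : {ffun 'I_k -> 'I_d} => [ffun i => f (s^-1%g i)]) => f _;
    by apply/ffunP => i; rewrite !ffunE (permK, permKV).
apply: eq_bigr => f _.
have -> : rowsub [ffun i => f (s i)] B = perm_mx s *m rowsub f B.
  by rewrite -row_permE; apply/matrixP => i j; rewrite !mxE ffunE.
rewrite det_mulmx det_perm mulrA [_ * (-1) ^+ s]mulrC.
by congr (_ * _ * _); apply: eq_bigr => i _; rewrite !mxE ffunE.
Qed.

Lemma mulmx_trmxC (C : numClosedFieldType) m n p (A : 'M[C]_(m, n)) (B : 'M[C]_(n, p)) :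
  (A *m B) ^t* = B ^t* *m A ^t*.
Proof. by rewrite trmx_mul map_mxM. Qed.

Lemma det_trmxC (C : numClosedFieldType) n (A : 'M[C]_n) :
  \det (A ^t*) = (\det A)^*%R.
Proof. by rewrite det_map_mx det_tr. Qed.

Lemma colsub_trmxC (C : numClosedFieldType) k d (E : 'M[C]_(d, k)) (f : 'I_k -> 'I_d) :
  colsub f (E ^t*) = (rowsub f E) ^t*.
Proof. by apply/matrixP => i j; rewrite !mxE. Qed.

(** By the Cauchy-Binet formula the three determinants are inner products of
    the vectors of maximal minors. *)
Lemma det_CauchySchwarz (C : numClosedFieldType) k d (E F : 'M[C]_(d, k)) :
  `|\det (E ^t* *m F)| ^+ 2 <= \det (E ^t* *m E) * \det (F ^t* *m F).
Proof.
pose I := {ffun 'I_k -> 'I_d}.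
pose minors (M : 'M[C]_(d, k)) : 'rV[C]_#|I| :=
  \row_i (\det (rowsub (enum_val i : I) M)).
have minorsE (M N : 'M[C]_(d, k)) :
    (k`!)%:R * \det (M ^t* *m N) = dotmx (minors N) (minors M).
  rewrite Cauchy_Binet dotmxE !mxE (reindex (fun i : 'I_#|I| => enum_val i : I)) /=; last first.
    by apply: onW_bij; exact: enum_val_bij.
  by apply: eq_bigr => f _; rewrite !mxE colsub_trmxC det_trmxC mulrC.
have k2 : 0 < (k`!)%:R ^+ 2 :> C by rewrite exprn_gt0// ltr0n fact_gt0.
rewrite -(ler_pM2l k2) [in leRHS]expr2 [leRHS]mulrACA !minorsE [leRHS]mulrC.
rewrite -[X in X ^+ 2 * _]ger0_norm ?ler0n// -exprMn -normrM minorsE.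
exact: CauchySchwarz.
Qed.

Lemma det_gram_ge0 (C : numClosedFieldType) k d (S : 'M[C]_(d, k)) :
  0 <= \det (S ^t* *m S).
Proof.
have kf : 0 < (k`!)%:R :> C by rewrite ltr0n fact_gt0.
rewrite -(pmulr_rge0 _ kf) Cauchy_Binet; apply: sumr_ge0 => f _.
by rewrite colsub_trmxC det_trmxC mulrC -normCK exprn_ge0.
Qed.

(** Full column rank is witnessed by [T^{-*} P], whose pairing with [T P] has
    determinant one: a vanishing Gram determinant would contradict
    [det_CauchySchwarz]. *)
Lemma det_gram_gt0 (C : numClosedFieldType) k d (T : 'M[C]_d) (P : 'M[C]_(d, k)) :
  T \in unitmx -> P ^t* *m P = 1%:M -> 0 < \det ((T *m P) ^t* *m (T *m P)).
Proof.
move=> hT hP; rewrite lt_neqAle det_gram_ge0 andbT eq_sym; apply/negP => /eqP z.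
have := det_CauchySchwarz ((invmx T) ^t* *m P) (T *m P).
rewrite z mulr0 mulmx_trmxC trmxCK mulmxA mulmxKV// hP det1 normr1 expr1n.
by rewrite ler10.
Qed.

(** Sequences, rather than row vectors, carry the diagonal, so that sorting and
    prefix products are available. *)
Definition diagC (R : realType) (d : nat) (s : seq R) : 'M[R[i]]_d :=
  diag_mx (\row_i (s`_i)%:C).

(** In the Cauchy-Binet expansion a minor on the rows [f] is weighted by the
    product of the entries of [s] at [f], which is at most that of the k largest
    entries. *)
Lemma det_compression_le (R : realType) k d (s : seq R) (S : 'M[R[i]]_(d, k)) :
  size s = d -> sorted >=%R s -> all (>= 0) s ->
  \det (S ^t* *m (diagC d s *m S))
    <= (\prod_(x <- take k s) x)%:C * \det (S ^t* *m S).
Proof.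
move=> ssz ss s0.
have kf : 0 < (k`!)%:R :> R[i] by rewrite ltr0n fact_gt0.
rewrite -(ler_pM2l kf) mulrCA !Cauchy_Binet mulr_sumr.
apply: ler_sum => f _; rewrite colsub_trmxC det_trmxC.
have -> : rowsub f (diagC d s *m S) =
    diag_mx (\row_i (s`_(f i))%:C) *m rowsub f S.
  by apply/matrixP => i j; rewrite mxE !mul_diag_mx !mxE.
rewrite det_mulmx det_diag mulrCA; set D := \det (rowsub f S).
have [/injectiveP finj|/injectivePn[i1 [i2 i12 fE]]] := boolP (injectiveb f).
  rewrite mulrC [D^* * D]mulrC -normCK [leRHS]mulrC ler_wpM2l ?exprn_ge0//.
  under eq_bigr do rewrite mxE.
  by rewrite -rmorph_prod lecR prod_inj_le.
have -> : D = 0 by apply: (determinant_alternate i12) => j; rewrite !mxE fE.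
by rewrite !mulr0.
Qed.

(** * Diagonalization and functional calculus of Hermitian matrices *)

Lemma unitary_perm (C : numClosedFieldType) n (p : 'S_n) :
  (perm_mx p : 'M[C]_n) \is unitarymx.
Proof.
by apply/unitarymxP; rewrite tr_perm_mx map_perm_mx -perm_mxM mulgV perm_mx1.
Qed.

Lemma trmxC_mulmx_unitary (C : numClosedFieldType) n (U : 'M[C]_n) :
  U \is unitarymx -> U ^t* *m U = 1%:M.
Proof. by move=> hU; rewrite -[LHS]mul1mx mulmxA mulmxKtV. Qed.

Lemma diagC_herm (R : realType) d (s : seq R) : (diagC d s) ^t* = diagC d s.
Proof.
apply/matrixP => i j; rewrite !mxE eq_sym; case: eqP => [->|_]; last first.
  by rewrite !mulr0n rmorph0.
by rewrite !mulr1n; apply/CrealP; rewrite complex_real.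
Qed.

Lemma diagC_perm (R : realType) d (s s' : seq R) :
  size s = d -> perm_eq s s' ->
  exists2 Q : 'M[R[i]]_d, Q \is unitarymx & diagC d s = Q ^t* *m diagC d s' *m Q.
Proof.
move=> ssz ss'; have ssz' : size s' == d by rewrite -(perm_size ss') ssz.
have /tuple_permP[p sE] : perm_eq s (Tuple ssz') by [].
exists (perm_mx p^-1); first exact: unitary_perm.
rewrite tr_perm_mx map_perm_mx invgK -col_permE -row_permE.
apply/matrixP => i j; rewrite !mxE (inj_eq perm_inj); congr (_%:C *+ _).
rewrite sE (nth_map i) ?size_enum_ord// nth_ord_enum (tnth_nth 0) /=.
by rewrite (set_nth_default 0)// (eqP ssz').
Qed.

(** The functional calculus does not depend on the chosen diagonalization.  The
    change of basis W between two of them intertwines the diagonals, so its entry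
    at (i, j) vanishes unless the eigenvalues agree there, and in that case their
    images under [phi] agree too. *)
Lemma mxfun_diag (R : realType) d (phi : R -> R) (U : 'M[R[i]]_d) (s : seq R) :
  size s = d -> U \is unitarymx ->
  mxfun phi (U ^t* *m diagC d s *m U) = U ^t* *m diagC d (map phi s) *m U.
Proof.
move=> ssz hU; set H := U ^t* *m _ *m U.
have /orthomx_spectralP : H \is normalmx.
  apply/orthomx_spectral_subproof.
  by exists (U, \row_i (s`_i)%:C) => //=; rewrite invmx_unitary.
rewrite /mxfun; set V := spectralmx H; set sp := spectral_diag H.
have hV : V \is unitarymx by exact: spectral_unitarymx.
rewrite invmx_unitary// => HV.
have comm : diag_mx sp *m (V *m U ^t*) = (V *m U ^t*) *m diagC d s.
  have := congr1 (fun M => V *m M *m U ^t*) HV.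
  rewrite {1}/H !mulmxA (unitarymxP hV) mul1mx => <-.
  by rewrite -[in LHS](mulmxA _ U) (unitarymxP hU) mulmx1.
set D := diag_mx _.
have comm' : D *m (V *m U ^t*) = (V *m U ^t*) *m diagC d (map phi s).
  apply/matrixP => i j; have /matrixP/(_ i j) := comm.
  rewrite !mul_diag_mx !mul_mx_diag !mxE.
  set w := \sum_k _; have [->|w0] := eqVneq w 0; first by rewrite !(mulr0, mul0r).
  rewrite mulrC => /(mulfI w0) ->; rewrite mulrC /=; congr (_ * _%:C).
  by rewrite (nth_map 0)// ssz.
rewrite -[RHS]mul1mx -(trmxC_mulmx_unitary hV) -!mulmxA; congr (_ *m _).
rewrite !mulmxA -comm' -!mulmxA; congr (_ *m _).
by rewrite (trmxC_mulmx_unitary hU) mulmx1.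
Qed.

Lemma hermitian_diagonalization (R : realType) d (H : 'M[R[i]]_d) :
  H ^t* = H ->
  exists U s, [/\ U \is unitarymx, size s = d, sorted >=%R s &
    H = U ^t* *m diagC d s *m U].
Proof.
move=> HH; have Hh : H \is hermsymmx by apply/is_hermitianmxP; rewrite expr0 scale1r.
have /hermitian_normalmx/orthomx_spectralP := Hh.
have := hermitian_spectral_diag_real Hh.
have := spectral_unitarymx H.
set V := spectralmx H; set sp := spectral_diag H => hV /mxOverP spR.
rewrite invmx_unitary// => HV.
pose s0 := [seq complex.Re (sp 0 i) | i <- enum 'I_d].
have s0sz : size s0 = d by rewrite size_map size_enum_ord.
have spE : diag_mx sp = diagC d s0.
  congr diag_mx; apply/rowP => i; rewrite !mxE (nth_map i) ?size_enum_ord//.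
  rewrite nth_ord_enum.
  by have /complex_realP[k ->] := spR 0 i.
have [Q hQ DQ] := @diagC_perm R d s0 (sort >=%R s0) s0sz ltac:(by rewrite perm_sym perm_sort).
exists (Q *m V), (sort >=%R s0); split.
- exact: mul_unitarymx.
- by rewrite size_sort.
- exact: (sort_sorted ge_total).
- by rewrite HV spE DQ mulmx_trmxC !mulmxA.
Qed.

(** Eigenvectors recover the eigenvalues from the quadratic form; this is how
    positivity of a matrix passes to its diagonalization. *)
Lemma diagC_quadratic_form (R : realType) d (U : 'M[R[i]]_d) (s : seq R) (i : 'I_d) :
  U \is unitarymx -> let x := col i (U ^t*) in
  x != 0 /\ (x ^t* *m (U ^t* *m diagC d s *m U) *m x) 0 0 = (s`_i)%:C.
Proof.
move=> hU x.
have xE : x = U ^t* *m delta_mx i 0 by rewrite /x colE.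
have Ux : U *m x = delta_mx i 0 by rewrite xE mulmxA (unitarymxP hU) mul1mx.
split.
  apply/eqP => x0; have /matrixP/(_ i 0) := Ux.
  by rewrite x0 mulmx0 !mxE !eqxx /= => /esym/eqP; rewrite oner_eq0.
rewrite !mulmxA -mulmx_trmxC Ux -!mulmxA Ux mul_diag_mx.
rewrite mxE (bigD1 i)//= big1 ?addr0.
  by rewrite !mxE !eqxx /= rmorph1 mul1r mulr1.
by move=> j ji; rewrite !mxE (negbTE ji) /= rmorph0 mul0r.
Qed.

Lemma posdef_powers (R : realType) d (A : 'M[R[i]]_d) : posdefmx A ->
  exists U a, [/\ U \is unitarymx, size a = d, all (> 0) a &
    forall p, mxpowR A p = U ^t* *m diagC d (map (fun x => powR x p) a) *m U].
Proof.
case=> /is_hermitianmxP; rewrite expr0 scale1r => /esym Ah Apos.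
have [U [a [hU asz _ AE]]] := hermitian_diagonalization Ah.
exists U, a; split; [exact: hU|exact: asz| |]; last first.
  by move=> p; rewrite /mxpowR AE (mxfun_diag _ asz hU).
apply/(all_nthP 0) => i; rewrite asz => id.
have [x0 xE] := diagC_quadratic_form a (Ordinal id) hU.
by have := Apos _ x0; rewrite {1}AE xE ltcR.
Qed.

Lemma mxpowR0 (R : realType) d (A : 'M[R[i]]_d) : posdefmx A -> mxpowR A 0 = 1%:M.
Proof.
move=> /posdef_powers[U [a [hU asz _ ->]]].
have -> : diagC d [seq powR x 0 | x <- a] = 1%:M.
  by apply/matrixP => i j; rewrite !mxE (nth_map 0) ?asz// powRr0.
by rewrite mulmx1 trmxC_mulmx_unitary.
Qed.

Lemma mxpowR1 (R : realType) d (A : 'M[R[i]]_d) : posdefmx A -> mxpowR A 1 = A.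
Proof.
case=> /is_hermitianmxP; rewrite expr0 scale1r => /esym Ah Apos.
have [U [a [hU asz _ AE]]] := hermitian_diagonalization Ah.
rewrite /mxpowR {1}AE (mxfun_diag _ asz hU) [RHS]AE.
suff -> : [seq powR x 1 | x <- a] = a by reflexivity.
rewrite -[RHS]map_id; apply/eq_in_map => x xa.
case/(nthP (0 : R)): xa => i; rewrite asz => id <- /=.
have [x0 xE] := diagC_quadratic_form a (Ordinal id) hU.
by rewrite powRr1// ltW//; have := Apos _ x0; rewrite {1}AE xE ltcR.
Qed.

Lemma mxpowRD (R : realType) d (A : 'M[R[i]]_d) p q : posdefmx A ->
  mxpowR A (p + q) = mxpowR A p *m mxpowR A q.
Proof.
move=> /posdef_powers[U [a [hU asz a0 AE]]]; rewrite !AE !mulmxA.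
rewrite (mulmxtVK _ hU) -[in RHS](mulmxA (U ^t*)).
suff -> : diagC d [seq powR x (p + q) | x <- a] =
  diagC d [seq powR x p | x <- a] *m diagC d [seq powR x q | x <- a] by reflexivity.
apply/matrixP => i j; rewrite mul_diag_mx !mxE !(nth_map 0) ?asz//.
rewrite powRD ?rmorphM ?mulrnAr//; apply/implyP => _.
by rewrite gt_eqF// (allP a0)// mem_nth ?asz.
Qed.

Lemma mxpowR_herm (R : realType) d (A : 'M[R[i]]_d) p : posdefmx A ->
  (mxpowR A p) ^t* = mxpowR A p.
Proof.
move=> /posdef_powers[U [a [hU asz a0 ->]]].
by rewrite !mulmx_trmxC trmxCK mulmxA diagC_herm.
Qed.

Lemma squared_singular_values (R : realType) d (M : 'M[R[i]]_d) :
  exists U e, [/\ U \is unitarymx, size e = d, sorted >=%R e, all (>= 0) e &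
    M ^t* *m M = U ^t* *m diagC d e *m U].
Proof.
have HM : (M ^t* *m M) ^t* = M ^t* *m M by rewrite mulmx_trmxC trmxCK.
have [U [e [hU esz es ME]]] := hermitian_diagonalization HM.
exists U, e; split => //.
apply/(all_nthP 0) => i; rewrite esz => id.
have [_ xE] := diagC_quadratic_form e (Ordinal id) hU.
rewrite -lecR -xE -ME !mulmxA -mulmx_trmxC -mulmxA mxE.
by apply: sumr_ge0 => j _; rewrite !mxE mulrC -normCK exprn_ge0.
Qed.

Lemma mxpowR_mxabs (R : realType) d (M U : 'M[R[i]]_d) (e : seq R) t :
  U \is unitarymx -> size e = d ->
  M ^t* *m M = U ^t* *m diagC d e *m U ->
  mxpowR (mxabs M) t = U ^t* *m diagC d (map (fun x => powR x (t / 2)) e) *m U.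
Proof.
move=> hU esz ME; rewrite /mxabs /mxpowR ME (mxfun_diag _ esz hU).
have sz' : size [seq powR x 2^-1 | x <- e] = d by rewrite size_map.
rewrite (mxfun_diag _ sz' hU).
suff -> : [seq powR x t | x <- [seq powR x 2^-1 | x <- e]] =
  [seq powR x (t / 2) | x <- e] by reflexivity.
by rewrite -map_comp; apply/eq_in_map => x _ /=; rewrite -powRrM mulrC.
Qed.

(** * Log-majorization of singular values *)

(** The map M expands k-dimensional squared volumes at most by the product of
    its k largest squared singular values. *)
Lemma det_gram_le (R : realType) k d (M U : 'M[R[i]]_d) (e : seq R)
    (S : 'M[R[i]]_(d, k)) :
  U \is unitarymx -> size e = d -> sorted >=%R e -> all (>= 0) e ->
  M ^t* *m M = U ^t* *m diagC d e *m U ->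
  \det ((M *m S) ^t* *m (M *m S))
    <= (\prod_(x <- take k e) x)%:C * \det (S ^t* *m S).
Proof.
move=> hU esz es e0 ME.
have -> : (M *m S) ^t* *m (M *m S) = (U *m S) ^t* *m (diagC d e *m (U *m S)).
  by rewrite !mulmx_trmxC -!mulmxA (mulmxA (M ^t*)) ME !mulmxA.
have -> : S ^t* *m S = (U *m S) ^t* *m (U *m S).
  by rewrite mulmx_trmxC -mulmxA (mulmxA (U ^t*)) trmxC_mulmx_unitary ?mul1mx.
exact: det_compression_le.
Qed.

(** The sequences hold squared singular values.  With S the image under T of
    the first k eigenvectors of [M^* M], the hypothesis says that [K^* L] maps S
    to S times the diagonal of the first k entries of [eM].  Hence
    [det ((K S)^* (L S))] is [det (S^* S)] times their product, and it is bounded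
    through [det_CauchySchwarz] and [det_gram_le]. *)
Lemma log_majorization_of_similar (R : realType) d (K L M T UK UL UM : 'M[R[i]]_d)
    (eK eL eM : seq R) k :
  T \in unitmx -> K ^t* *m L *m T = T *m (M ^t* *m M) ->
  UK \is unitarymx -> size eK = d -> sorted >=%R eK -> all (>= 0) eK ->
  K ^t* *m K = UK ^t* *m diagC d eK *m UK ->
  UL \is unitarymx -> size eL = d -> sorted >=%R eL -> all (>= 0) eL ->
  L ^t* *m L = UL ^t* *m diagC d eL *m UL ->
  UM \is unitarymx -> size eM = d ->
  M ^t* *m M = UM ^t* *m diagC d eM *m UM ->
  (k <= d)%N ->
  (\prod_(x <- take k eM) x) ^+ 2 <=
    \prod_(x <- take k eK) x * \prod_(x <- take k eL) x.
Proof.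
move=> hT KL hUK szK sK pK EK hUL szL sL pL EL hUM szM EM kd.
pose P : 'M[R[i]]_(d, k) := pid_mx k.
have hP : P ^t* *m P = 1%:M.
  by rewrite tr_pid_mx map_pid_mx pid_mx_id// pid_mx_1.
have DP : diagC d eM *m P = P *m diagC k eM.
  apply/matrixP => i j; rewrite mul_diag_mx mul_mx_diag !mxE mulrC.
  by case: eqP => [->|_] //=; rewrite !mul0r.
pose S := T *m UM ^t* *m P.
have TU : T *m UM ^t* \in unitmx.
  by rewrite unitmx_mul hT unitarymx_unit ?trmxC_unitary.
have KLS : K ^t* *m L *m S = S *m diagC k eM.
  rewrite /S !mulmxA KL EM !mulmxA (mulmxtVK _ hUM).
  by rewrite -(mulmxA _ (diagC d eM)) DP !mulmxA.
have detKL : \det ((K *m S) ^t* *m (L *m S)) =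
    \det (S ^t* *m S) * (\prod_(x <- take k eM) x)%:C.
  rewrite mulmx_trmxC -mulmxA (mulmxA (K ^t*)) KLS mulmxA det_mulmx det_diag.
  congr (_ * _); rewrite prod_take ?szM// rmorph_prod.
  by apply: eq_bigr => i _; rewrite mxE.
have gpos : 0 < \det (S ^t* *m S) by exact: det_gram_gt0.
have := det_CauchySchwarz (K *m S) (L *m S).
rewrite detKL; move=> /le_trans h.
have := h _ (ler_pM (det_gram_ge0 _) (det_gram_ge0 _)
  (det_gram_le S hUK szK sK pK EK) (det_gram_le S hUL szL sL pL EL)).
set g := \det _ in gpos *.
rewrite normrM exprMn (gtr0_norm gpos) [leRHS]mulrACA -expr2 [leRHS]mulrC.
rewrite ler_pM2l ?exprn_gt0// real_normK ?complex_real//.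
by rewrite -rmorphXn -rmorphM /= lecR.
Qed.

(** * Unitarily invariant norms of diagonal matrices *)

Lemma uinorm_conj (R : realType) d (nrm : 'M[R[i]]_d -> R) (U D : 'M[R[i]]_d) :
  unitarily_invariant_norm nrm -> U \is unitarymx ->
  nrm (U ^t* *m D *m U) = nrm D.
Proof.
by move=> hn hU; rewrite (uinormU hn _ _ hU) ?trmxC_unitary.
Qed.

Lemma uinorm_diag_perm (R : realType) d (nrm : 'M[R[i]]_d -> R) (s s' : seq R) :
  unitarily_invariant_norm nrm -> size s = d -> perm_eq s s' ->
  nrm (diagC d s) = nrm (diagC d s').
Proof.
move=> hn ssz ss'; have [Q hQ ->] := diagC_perm ssz ss'.
exact: uinorm_conj.
Qed.

Lemma uinormZ_real (R : realType) d (nrm : 'M[R[i]]_d -> R) (c : R) (Y : 'M[R[i]]_d) :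
  unitarily_invariant_norm nrm -> 0 <= c -> nrm (c%:C *: Y) = c * nrm Y.
Proof. by move=> hn c0; rewrite (uinormZ hn) ger0_norm ?lecR. Qed.

Lemma uinorm_half_sum (R : realType) d (nrm : 'M[R[i]]_d -> R) (U V D : 'M[R[i]]_d) :
  unitarily_invariant_norm nrm -> U \is unitarymx -> V \is unitarymx ->
  nrm ((2^-1 : R)%:C *: (U *m D + V *m D)) <= nrm D.
Proof.
move=> hn hU hV; have h1 : (1%:M : 'M[R[i]]_d) \is unitarymx.
  by apply/unitarymxP; rewrite trmx1 map_mx1 mulmx1.
have := uinormD hn (U *m D) (V *m D).
rewrite -[X in nrm X + _]mulmx1 -[X in _ + nrm X]mulmx1.
rewrite (uinormU hn _ hU h1) (uinormU hn _ hV h1) (uinormZ_real _ hn) ?invr_ge0//.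
by move: (nrm _) (nrm _) => y z; lra.
Qed.

Lemma diag_unimodular_unitary (C : numClosedFieldType) d (w : 'rV[C]_d) :
  (forall i, `|w 0 i| = 1) -> diag_mx w \is unitarymx.
Proof.
move=> w1; apply/unitarymxP/matrixP => i j.
rewrite mul_diag_mx !mxE eq_sym; case: eqP => [->|_]; last first.
  by rewrite !mulr0n rmorph0 mulr0.
by rewrite !mulr1n -normCK w1 expr1n.
Qed.

(** A number in [0,1] is the average of two conjugate numbers of modulus one.
    Hence [diagC d s] is the average of two unitary multiples of
    [diagC d s']. *)
Lemma uinorm_diag_mono (R : realType) d (nrm : 'M[R[i]]_d -> R) (s s' : seq R) :
  unitarily_invariant_norm nrm -> (forall i, 0 <= s`_i <= s'`_i) ->
  nrm (diagC d s) <= nrm (diagC d s').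
Proof.
move=> hn ss'.
pose c (i : 'I_d) := s`_i / s'`_i.
have c01 i : 0 <= c i <= 1.
  have /andP[s0 sle] := ss' i; rewrite /c.
  have [z|nz] := eqVneq s'`_i 0; first by rewrite z invr0 mulr0 lexx ler01.
  have p : 0 < s'`_i by rewrite lt_neqAle eq_sym nz (le_trans s0).
  by rewrite divr_ge0 ?(ltW p)//= ler_pdivrMr// mul1r.
(* The unimodular number with real part [c i]. *)
pose w (i : 'I_d) : R[i] := (c i +i* Num.sqrt (1 - c i ^+ 2))%C.
have w1 i : `|w i| = 1.
  have /andP[c0 c1] := c01 i.
  rewrite normc_def /= sqr_sqrtr ?subr_ge0 ?expr_le1//.
  by rewrite addrC subrK sqrtr1.
have hW : diag_mx (\row_i w i) \is unitarymx.
  by apply: diag_unimodular_unitary => i; rewrite mxE.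
have hW' : diag_mx (\row_i (w i)^*%R) \is unitarymx.
  by apply: diag_unimodular_unitary => i; rewrite mxE norm_conjC.
have -> : diagC d s = (2^-1 : R)%:C *:
   (diag_mx (\row_i w i) *m diagC d s' + diag_mx (\row_i (w i)^*%R) *m diagC d s').
  apply/matrixP => i j; rewrite [RHS]mxE [X in _ * X]mxE.
  rewrite !mul_diag_mx !mxE; case: eqP => [_|_]; last by rewrite !mulr0n !mulr0 addr0 mulr0.
  rewrite !mulr1n -mulrDl.
  have -> : w i + (w i)^*%R = (2 * c i)%:C.
    by apply/eqP; rewrite eq_complex /= subrr mulr2n mulrDl !mul1r !eqxx.
  rewrite -!rmorphM /=; congr (_%:C).
  rewrite !mulrA mulVf ?mul1r ?pnatr_eq0// /c.
  have [z|nz] := eqVneq s'`_i 0; last by rewrite divfK.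
  by have := ss' i; rewrite z mulr0 => /le_anti.
exact (uinorm_half_sum (diagC d s') hn hW hW').
Qed.

(** Up to monotonicity, [y = p + q - x].  Then [(x, y)] is a convex combination
    of [(p, q)] and [(q, p)], on which the norm takes the same value. *)
Lemma uinorm_diag_exchange (R : realType) d (nrm : 'M[R[i]]_d -> R)
    (p q x y : R) (s : seq R) :
  unitarily_invariant_norm nrm -> (size s).+2 = d -> all (>= 0) s ->
  0 <= q -> q <= x <= p -> 0 <= y <= p + q - x ->
  nrm (diagC d [:: x, y & s]) <= nrm (diagC d [:: p, q & s]).
Proof.
move=> hn ssz s0 q0 /andP[qx xp] /andP[y0 yle].
have ps i : 0 <= s`_i by exact: nth_ge0.
apply: (@le_trans _ _ (nrm (diagC d [:: x, p + q - x & s]))).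
  apply: uinorm_diag_mono => // -[|[|i]] /=; rewrite ?lexx ?andbT ?ps ?y0//.
  exact: le_trans q0 qx.
have [pq|pq] := eqVneq p q.
  have -> : x = p by apply/eqP; rewrite eq_le xp pq.
  by rewrite (_ : p + q - p = q) //; ring.
have pq0 : 0 < p - q by rewrite subr_gt0 lt_neqAle eq_sym pq (le_trans qx).
pose th := (x - q) / (p - q).
have th0 : 0 <= th by rewrite divr_ge0 ?subr_ge0 ?(ltW pq0)// (le_trans qx).
have th1 : 0 <= 1 - th by rewrite subr_ge0 ler_pdivrMr//; lra.
have -> : diagC d [:: x, p + q - x & s] =
    th%:C *: diagC d [:: p, q & s] + (1 - th)%:C *: diagC d [:: q, p & s].
  apply/matrixP => i j; rewrite !mxE.
  case: eqP => _; last by rewrite !mulr0n !mulr0 addr0.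
  rewrite !mulr1n -!rmorphM -rmorphD /=; congr (_%:C).
  case: (nat_of_ord i) => [|[|k]] /=; rewrite /th; field; exact: lt0r_neq0.
apply: le_trans (uinormD hn _ _) _; rewrite !uinormZ_real//.
have -> : nrm (diagC d [:: q, p & s]) = nrm (diagC d [:: p, q & s]).
  apply: uinorm_diag_perm => //.
  by apply/seq.permP => P /=; rewrite addnCA.
by rewrite -mulrDl addrC subrK mul1r.
Qed.

(** The norm is only defined at size d; extending it by zero to sequences of
    other sizes is compatible with permutations. *)
Lemma uinorm_log_majorization (R : realType) d (nrm : 'M[R[i]]_d -> R)
    (a b : seq R) :
  unitarily_invariant_norm nrm -> size a = d -> size b = d ->
  sorted >=%R a -> sorted >=%R b -> all (>= 0) a -> all (>= 0) b ->
  (forall k, \prod_(x <- take k a) x <= \prod_(x <- take k b) x) ->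
  nrm (diagC d a) <= nrm (diagC d b).
Proof.
move=> hn asz bsz sa sb a0 b0 hk.
pose F s := if size s == d then nrm (diagC d s) else 0.
have FE s : size s = d -> F s = nrm (diagC d s) by move=> ssz; rewrite /F ssz eqxx.
rewrite -!FE//.
apply: (@weak_log_majorization _ F d _ _ _ [::]) => //.
- move=> s s' ss'; rewrite /F -(perm_size ss'); case: eqP => // ssz.
  exact: uinorm_diag_perm.
- by move=> s s' ssz ssz' ss'; rewrite !FE//; exact: uinorm_diag_mono.
- by move=> p q x y s ssz *; rewrite !FE//; exact: uinorm_diag_exchange.
- by rewrite asz bsz.
Qed.

(** The optimal scale, a square root of [b / a], degenerates when [a] or [b]
    vanishes; [c = b / z] gives the same bound without square roots. *)
Lemma le_amgm_all_scales (R : realFieldType) (z a b : R) :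
  0 <= z -> 0 <= a -> 0 <= b ->
  (forall c, 0 < c -> z <= (c * a + c^-1 * b) / 2) -> z ^+ 2 <= a * b.
Proof.
move=> z0 a0 b0 hc.
have [->|znz] := eqVneq z 0; first by rewrite expr0n mulr_ge0.
have zp : 0 < z by rewrite lt_neqAle eq_sym znz.
have [bz|bnz] := eqVneq b 0.
  (* Any [c] with [c * a < z] contradicts the hypothesis. *)
  have a1 : 0 < a + 1 by lra.
  have := hc (z / (a + 1)) ltac:(by rewrite divr_gt0).
  rewrite bz mulr0 addr0 ler_pdivlMr// mulrAC ler_pdivlMr//; nra.
have bp : 0 < b by rewrite lt_neqAle eq_sym bnz.
have := hc (b / z) ltac:(by rewrite divr_gt0).
rewrite invf_div divfK// ler_pdivlMr// -lerBlDr mulrAC ler_pdivlMr//.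
by rewrite expr2; nra.
Qed.

(** Entrywise [z <= (c x + c^-1 y) / 2] for every scale [c > 0], so the norm of
    z satisfies the same bounds with the norms of x and y; [le_amgm_all_scales]
    turns them into a product. *)
Lemma uinorm_diag_CauchySchwarz (R : realType) d (nrm : 'M[R[i]]_d -> R)
    (x y z : seq R) :
  unitarily_invariant_norm nrm -> size x = d -> size y = d -> size z = d ->
  (forall i, 0 <= x`_i) -> (forall i, 0 <= y`_i) -> (forall i, 0 <= z`_i) ->
  (forall i, z`_i ^+ 2 = x`_i * y`_i) ->
  nrm (diagC d z) ^+ 2 <= nrm (diagC d x) * nrm (diagC d y).
Proof.
move=> hn xsz ysz zsz x0 y0 z0 zE; apply: le_amgm_all_scales => [|||c c0];
  rewrite ?(uinorm_ge0 hn)//.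
pose m := mkseq (fun i => (c * x`_i + c^-1 * y`_i) / 2) d.
apply: (@le_trans _ _ (nrm (diagC d m))).
  apply: uinorm_diag_mono => // i; rewrite z0 /=.
  have [id|id] := ltnP i d; last by rewrite !nth_default ?size_mkseq ?zsz.
  rewrite nth_mkseq//.
  have hm : 0 <= (c * x`_i + c^-1 * y`_i) / 2.
    by rewrite divr_ge0// addr_ge0// mulr_ge0// ?invr_ge0 ltW.
  rewrite -ler_sqr ?nnegrE// zE.
  have -> : x`_i * y`_i = (c * x`_i) * (c^-1 * y`_i).
    by rewrite mulrACA mulfV ?mul1r// lt0r_neq0.
  have := sqr_ge0 (c * x`_i - c^-1 * y`_i); nra.
have -> : diagC d m = (2^-1 : R)%:C *: (c%:C *: diagC d x + (c^-1)%:C *: diagC d y).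
  apply/matrixP => i j; rewrite !mxE.
  case: eqP => _; last by rewrite !mulr0n !mulr0 addr0 mulr0.
  rewrite !mulr1n -!rmorphM -rmorphD -rmorphM nth_mkseq//; congr (_%:C).
  by rewrite mulrC.
rewrite (uinormZ_real _ hn) ?invr_ge0// mulrC ler_pM2r ?invr_gt0//.
apply: le_trans (uinormD hn _ _) _.
by rewrite !uinormZ_real// ?invr_ge0 ltW.
Qed.

(** * Log-convexity of the Heinz interpolation *)

(** Raised to the power [t / 2], the log-majorization of squared singular values
    compares [|M|^t] with the entrywise geometric mean z of [|K|^t] and
    [|L|^t].  The Cauchy-Schwarz inequality separates the two factors. *)
Lemma uinorm_similar_CauchySchwarz (R : realType) d (nrm : 'M[R[i]]_d -> R)
    (K L M T : 'M[R[i]]_d) (t : R) :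
  unitarily_invariant_norm nrm -> 0 < t ->
  T \in unitmx -> K ^t* *m L *m T = T *m (M ^t* *m M) ->
  nrm (mxpowR (mxabs M) t) ^+ 2 <=
    nrm (mxpowR (mxabs K) t) * nrm (mxpowR (mxabs L) t).
Proof.
move=> hn t0 hT KL.
have [UK [eK [hUK szK sK pK EK]]] := squared_singular_values K.
have [UL [eL [hUL szL sL pL EL]]] := squared_singular_values L.
have [UM [eM [hUM szM sM pM EM]]] := squared_singular_values M.
rewrite (mxpowR_mxabs t hUM szM EM) (uinorm_conj _ hn hUM).
rewrite (mxpowR_mxabs t hUK szK EK) (uinorm_conj _ hn hUK).
rewrite (mxpowR_mxabs t hUL szL EL) (uinorm_conj _ hn hUL).
set r := t / 2; have r0 : 0 <= r by rewrite divr_ge0 ?ltW.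
have r20 : 0 <= r / 2 by rewrite divr_ge0.
pose pw (e : seq R) (i : nat) := powR e`_i r.
have pwE e : size e = d -> [seq powR x r | x <- e] = mkseq (pw e) d.
  move=> sze; apply: (@eq_from_nth _ 0); rewrite ?size_mkseq ?size_map// => i.
  by rewrite sze => id; rewrite (nth_map 0) ?sze// nth_mkseq.
rewrite !pwE// {pwE}.
pose z := mkseq (fun i => powR (eK`_i * eL`_i) (r / 2)) d.
have pw0 e i : 0 <= (mkseq (pw e) d)`_i.
  have [id|id] := ltnP i d; last by rewrite nth_default ?size_mkseq.
  by rewrite nth_mkseq// powR_ge0.
have z0 i : 0 <= z`_i.
  have [id|id] := ltnP i d; last by rewrite nth_default ?size_mkseq.
  by rewrite nth_mkseq// powR_ge0.
apply: (@le_trans _ _ (nrm (diagC d z) ^+ 2)); last first.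
  apply: (uinorm_diag_CauchySchwarz hn); rewrite ?size_mkseq//.
  move=> i; have [id|id] := ltnP i d; last first.
    by rewrite !nth_default ?size_mkseq// mulr0 expr0n.
  rewrite !nth_mkseq// /pw -powRM ?nth_ge0//.
  by rewrite -powR_mulrn ?powR_ge0// -powRrM divfK.
rewrite ler_sqr ?nnegrE ?(uinorm_ge0 hn)//.
apply: (uinorm_log_majorization hn); rewrite ?size_mkseq//.
- apply: sorted_mkseq => i j ij.
  by apply: ge0_ler_powR; rewrite ?nnegrE ?nth_ge0// nth_decr.
- apply: sorted_mkseq => i j ij.
  apply: (ge0_ler_powR r20); rewrite ?nnegrE ?mulr_ge0 ?nth_ge0//.
  by apply: ler_pM; rewrite ?nth_ge0 ?nth_decr.
- by apply/(all_nthP 0) => i _.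
- by apply/(all_nthP 0) => i _.
have small k : (k <= d)%N ->
    \prod_(x <- take k (mkseq (pw eM) d)) x <= \prod_(x <- take k z) x.
  move=> kd; have mkE (u : nat -> R) : \prod_(x <- take k (mkseq u d)) x = \prod_(i < k) u i.
    rewrite prod_take ?size_mkseq//; apply: eq_bigr => i _.
    by rewrite nth_mkseq// (leq_trans (ltn_ord i)).
  rewrite !mkE (prod_powR k r (fun i => nth_ge0 i pM)).
  rewrite (prod_powR k (r / 2) (fun i => mulr_ge0 (nth_ge0 i pK) (nth_ge0 i pL))).
  have := log_majorization_of_similar hT KL hUK szK sK pK EK hUL szL sL pL EL
    hUM szM EM kd.
  rewrite !prod_take ?szM ?szK ?szL// -big_split /= => h.
  have -> : powR (\prod_(i < k) eM`_i) r = powR ((\prod_(i < k) eM`_i) ^+ 2) (r / 2).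
    rewrite -powR_mulrn ?prodr_ge0// => [|i _]; rewrite ?nth_ge0//.
    by rewrite -powRrM mulrC divfK.
  apply: (ge0_ler_powR r20); rewrite ?nnegrE ?exprn_ge0 ?prodr_ge0// => i _;
    by rewrite ?mulr_ge0 ?nth_ge0.
move=> k; have [/small//|/ltnW dk] := leqP k d.
by have := small d (leqnn d); rewrite !take_oversize ?size_mkseq.
Qed.

(** Here [a1, a2, a] and [b1, b2, b] stand for the powers of A and of B at
    the two end points and at the midpoint, and T for the power of B that moves
    the midpoint to the first end point. *)
Lemma gram_similarity (C : numClosedFieldType) d (X a1 b1 a2 b2 a b T : 'M[C]_d) :
  a1 ^t* = a1 -> b1 ^t* = b1 -> a ^t* = a -> b ^t* = b ->
  a1 *m a2 = a *m a -> T *m b = b1 -> b2 *m T = b ->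
  (a1 *m X *m b1) ^t* *m (a2 *m X *m b2) *m T =
    T *m ((a *m X *m b) ^t* *m (a *m X *m b)).
Proof.
move=> ha1 hb1 ha hb haa hTb hbT.
rewrite !mulmx_trmxC ha1 hb1 ha hb -hTb -!mulmxA hbT; do 3 congr (_ *m _).
by rewrite !mulmxA haa.
Qed.

(** This is midpoint convexity of the logarithm of [g], stated as a product so
    that [g] may vanish. *)
Lemma uinorm_heinz_log_midconvex (R : realType) d (A B X : 'M[R[i]]_d)
    (nrm : 'M[R[i]]_d -> R) (t x y : R) :
  posdefmx A -> posdefmx B -> unitarily_invariant_norm nrm -> 0 < t ->
  let g (u : R) := nrm (mxpowR (mxabs (mxpowR A (1 - u) *m X *m mxpowR B u)) t) in
  g ((x + y) / 2) ^+ 2 <= g x * g y.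
Proof.
move=> hA hB hn t0 /=; set m := (x + y) / 2.
have BB : mxpowR B (x - m) *m mxpowR B (- (x - m)) = 1%:M.
  by rewrite -(mxpowRD _ _ hB) subrr (mxpowR0 hB).
apply: (uinorm_similar_CauchySchwarz hn t0 (mulmx1_unit BB).1).
apply: gram_similarity.
- exact: mxpowR_herm.
- exact: mxpowR_herm.
- exact: mxpowR_herm.
- exact: mxpowR_herm.
- suff e : 1 - x + (1 - y) = 1 - m + (1 - m).
    by rewrite -(mxpowRD (1 - x) (1 - y) hA) e (mxpowRD (1 - m) (1 - m) hA).
  by rewrite /m; field.
- rewrite -(mxpowRD _ _ hB); suff -> : x - m + m = x by reflexivity.
  by ring.
- rewrite -(mxpowRD _ _ hB); suff -> : y + (x - m) = m by reflexivity.
  by rewrite /m; field.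
Qed.

(** * Boundedness of the Heinz interpolation *)

(** Uniform boundedness of the powers on [0,1] stands in for their
    continuity. *)
Definition entry_bounded (R : realType) m n (F : R -> 'M[R[i]]_(m, n)) : Prop :=
  exists C : R[i], forall u, 0 <= u <= 1 -> forall i j, `|F u i j| <= C.

Lemma entry_bounded_cst (R : realType) m n (M : 'M[R[i]]_(m, n)) :
  entry_bounded (fun _ : R => M).
Proof.
exists (\sum_i \sum_j `|M i j|) => _ _ i j.
rewrite (bigD1 i)//= (bigD1 j)//= -addrA lerDl addr_ge0//.
  by apply: sumr_ge0.
by apply: sumr_ge0 => k _; apply: sumr_ge0.
Qed.

Lemma entry_bounded_mul (R : realType) m n p (F : R -> 'M[R[i]]_(m, n))
    (G : R -> 'M[R[i]]_(n, p)) :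
  entry_bounded F -> entry_bounded G -> entry_bounded (fun u => F u *m G u).
Proof.
move=> [C hC] [D hD]; exists (\sum_(k < n) C * D) => u hu i j.
rewrite mxE; apply: le_trans (ler_norm_sum _ _ _) _; apply: ler_sum => k _.
by rewrite normrM ler_pM// ?hC ?hD.
Qed.

Lemma entry_bounded_mxpowR (R : realType) d (A : 'M[R[i]]_d) (h : R -> R) :
  posdefmx A -> (forall u, 0 <= u <= 1 -> 0 <= h u <= 1) ->
  entry_bounded (fun u => mxpowR A (h u)).
Proof.
move=> /posdef_powers[U [a [hU asz a0 AE]]] hh.
suff hD : entry_bounded (fun u => diagC d [seq powR x (h u) | x <- a]).
  have [C hC] := entry_bounded_mul
    (entry_bounded_mul (entry_bounded_cst (U ^t*)) hD) (entry_bounded_cst U).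
  by exists C => u hu i j; rewrite AE; exact: hC.
exists (1 + \sum_(k < d) a`_k)%:C => u hu i j.
have a0' (k : 'I_d) : 0 <= a`_k by rewrite ltW// (allP a0)// mem_nth// asz.
have s0 : 0 <= \sum_(k < d) a`_k by apply: sumr_ge0.
rewrite !mxE; case: eqP => _; last by rewrite mulr0n normr0 lecR addr_ge0.
rewrite mulr1n (nth_map 0) ?asz// ger0_norm ?lecR ?powR_ge0//.
have ai : a`_i <= \sum_(k < d) a`_k.
  by rewrite (bigD1 i)//= lerDl; apply: sumr_ge0.
have /andP[h0 h1] := hh u hu.
have [a1|a1] := leP 1 a`_i.
  apply: (@le_trans _ _ (powR a`_i 1)); first exact: ler_powR.
  by rewrite powRr1 ?a0'//; lra.
apply: (@le_trans _ _ (powR 1 (h u))).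
  by apply: (ge0_ler_powR h0); rewrite ?nnegrE ?a0' ?ler01// ltW.
by rewrite powR1 lerDl.
Qed.

(** Each squared singular value is at most the trace of [F^* F], which is the sum
    of the squared moduli of the entries. *)
Lemma uinorm_mxabs_bounded (R : realType) d (nrm : 'M[R[i]]_d -> R) (t : R)
    (F : R -> 'M[R[i]]_d) :
  unitarily_invariant_norm nrm -> 0 < t -> entry_bounded F ->
  exists C, forall u, 0 <= u <= 1 -> nrm (mxpowR (mxabs (F u)) t) <= C.
Proof.
move=> hn t0 [C hC].
pose c := complex.Re (\sum_(i < d) \sum_(j < d) C ^+ 2).
exists (nrm (diagC d (nseq d (powR c (t / 2))))) => u hu.
have [U [e [hU esz _ e0 ME]]] := squared_singular_values (F u).
rewrite (mxpowR_mxabs t hU esz ME) (uinorm_conj _ hn hU).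
have trE : \tr (diagC d e) = \tr ((F u) ^t* *m F u).
  by rewrite ME mxtrace_mulC mulmxA (unitarymxP hU) mul1mx.
apply: (uinorm_diag_mono hn) => i.
have [id|id] := ltnP i d; last by rewrite !nth_default ?size_map ?size_nseq ?esz ?lexx.
rewrite (nth_map 0) ?esz// nth_nseq id powR_ge0 /=.
have ec : e`_i <= c.
  suff : (e`_i)%:C <= \sum_(i < d) \sum_(j < d) C ^+ 2 by rewrite lecE => /andP[].
  apply: (@le_trans _ _ (\tr (diagC d e))).
    rewrite /mxtrace (bigD1 (Ordinal id))//= !mxE eqxx mulr1n lerDl.
    by apply: sumr_ge0 => j _; rewrite !mxE eqxx mulr1n ler0c nth_ge0.
  rewrite trE /mxtrace; apply: ler_sum => k _; rewrite mxE; apply: ler_sum => j _.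
  rewrite !mxE mulrC -normCK !expr2.
  by apply: ler_pM => //; exact: hC.
apply: ge0_ler_powR; rewrite ?nnegrE ?nth_ge0//.
  by rewrite divr_ge0 ?ltW.
by apply: le_trans ec; rewrite nth_ge0.
Qed.

(** * Convexity and dyadic refinement *)

Definition below_chords (R : realType) (f : R -> R) : Prop :=
  forall a b s : R, 0 <= a <= 1 -> 0 <= b <= 1 -> 0 <= s <= 1 ->
    f ((1 - s) * a + s * b) <= (1 - s) * f a + s * f b.

Lemma onem_itv01 (R : realDomainType) (u : R) : 0 <= u <= 1 -> 0 <= 1 - u <= 1.
Proof. by rewrite subr_ge0 gerBl andbC. Qed.

(** Every point of [0,1] is the midpoint of an end point and another point of
    [0,1], so an upper bound of [h] may be halved; after n halvings it is
    [C / 2 ^+ n]. *)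
Lemma midconvex_le0 (R : realType) (h : R -> R) (C : R) :
  (forall s, 0 <= s <= 1 -> h s <= C) ->
  (forall x y, 0 <= x <= 1 -> 0 <= y <= 1 -> h ((x + y) / 2) <= (h x + h y) / 2) ->
  h 0 <= 0 -> h 1 <= 0 -> forall s, 0 <= s <= 1 -> h s <= 0.
Proof.
move=> hC hmid h0 h1.
have halve n : forall s, 0 <= s <= 1 -> 2 ^+ n * h s <= C.
  elim: n => [|n IHn] s hs; first by rewrite expr0 mul1r hC.
  have p2 : 0 < 2 ^+ n :> R by rewrite exprn_gt0.
  rewrite exprSr -mulrA; have [s2|s2] := leP s (1 / 2).
    have hs' : 0 <= 2 * s <= 1 by lra.
    apply: le_trans (IHn _ hs'); rewrite ler_pM2l//.
    have := hmid 0 (2 * s) ltac:(lra) hs'.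
    have -> : (0 + 2 * s) / 2 = s by lra.
    lra.
  have hs' : 0 <= 2 * s - 1 <= 1 by lra.
  apply: le_trans (IHn _ hs'); rewrite ler_pM2l//.
  have := hmid 1 (2 * s - 1) ltac:(lra) hs'.
  have -> : (1 + (2 * s - 1)) / 2 = s by lra.
  lra.
move=> s hs; rewrite leNgt; apply/negP => hs0.
have C0 : 0 <= C by apply: le_trans (ltW hs0) (hC _ hs).
have := archi_boundP (divr_ge0 C0 (ltW hs0)).
set n := Num.bound _ => hn.
have := halve n s hs; rewrite -ler_pdivlMr// => /le_lt_trans/(_ hn).
by rewrite -natrX ltr_nat ltnNge ltnW// ltn_expl.
Qed.

Lemma midconvex_below_chords (R : realType) (f : R -> R) (C : R) :
  (forall s, 0 <= s <= 1 -> f s <= C) ->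
  (forall x y, 0 <= x <= 1 -> 0 <= y <= 1 -> f ((x + y) / 2) <= (f x + f y) / 2) ->
  below_chords f.
Proof.
move=> fC fmid a b s ha hb hs.
pose seg (s : R) := (1 - s) * a + s * b.
have hseg x : 0 <= x <= 1 -> 0 <= seg x <= 1 by move=> hx; rewrite /seg; nra.
pose h x := f (seg x) - ((1 - x) * f a + x * f b).
suff : h s <= 0 by rewrite subr_le0.
apply: (@midconvex_le0 _ h (C + `|f a| + `|f b|)) => //.
- move=> x hx; rewrite /h; have := fC _ (hseg _ hx).
  have := ler_norm (- f a); have := ler_norm (- f b); rewrite !normrN.
  have := normr_ge0 (f a); have := normr_ge0 (f b).
  nra.
- move=> x y hx hy; rewrite /h.
  have -> : seg ((x + y) / 2) = (seg x + seg y) / 2 by rewrite /seg; field.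
  have := fmid _ _ (hseg _ hx) (hseg _ hy); lra.
- by rewrite /h /seg subr0 !mul1r !mul0r !addr0 subrr.
- by rewrite /h /seg subrr !mul1r !mul0r !add0r subrr.
Qed.

(** The two hypotheses give [(p * q) ^+ 2 <= (a * a') * (b * b')], and the
    arithmetic mean dominates the geometric one. *)
Lemma mul_le_mean (R : realFieldType) (p q a b a' b' : R) :
  0 <= p -> 0 <= q -> 0 <= a -> 0 <= b -> 0 <= a' -> 0 <= b' ->
  p ^+ 2 <= a * b -> q ^+ 2 <= a' * b' -> p * q <= (a * a' + b * b') / 2.
Proof.
move=> p0 q0 a0 b0 a'0 b'0 hp hq.
have hpq : (p * q) ^+ 2 <= (a * a') * (b * b').
  by rewrite exprMn [leRHS]mulrACA; apply: ler_pM; rewrite ?exprn_ge0.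
have s0 : 0 <= (a * a' + b * b') / 2 by rewrite divr_ge0 ?addr_ge0 ?mulr_ge0.
rewrite -(@ler_sqr _ (p * q)) ?nnegrE ?s0 ?mulr_ge0//; apply: le_trans hpq _.
by have := sqr_ge0 (a * a' - b * b'); lra.
Qed.

Lemma log_midconvex_below_chords (R : realType) (g : R -> R) (C : R) :
  (forall u, 0 <= g u) -> (forall u, 0 <= u <= 1 -> g u <= C) ->
  (forall x y, g ((x + y) / 2) ^+ 2 <= g x * g y) ->
  below_chords (fun u => g u * g (1 - u)).
Proof.
move=> g0 gC gmid; apply: (@midconvex_below_chords _ _ (C * C)) => [u hu|x y _ _].
  by rewrite ler_pM// gC// onem_itv01.
have := gmid (1 - x) (1 - y).
rewrite (_ : (1 - x + (1 - y)) / 2 = 1 - (x + y) / 2); last by field.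
by apply: mul_le_mean.
Qed.

(** Both recursions are the fact that [r_ n v] is the distance from
    [2 ^+ n * v] to the nearest integer. *)
Lemma r_S_left (R : realType) n (v : R) : v <= 1 / 2 -> r_ n.+1 v = r_ n (2 * v).
Proof.
move=> hv; elim: n => [|n IHn]; last by rewrite /= -IHn.
rewrite /=; have -> : Num.min v (1 - v) = v by apply/min_idPl; lra.
by [].
Qed.

Lemma r_S_right (R : realType) n (v : R) :
  1 / 2 <= v -> r_ n.+1 v = r_ n (2 * v - 1).
Proof.
move=> hv; elim: n => [|n IHn]; last by rewrite /= -IHn.
rewrite /=; have -> : Num.min v (1 - v) = 1 - v by apply/min_idPr; lra.
by rewrite minC; congr Num.min; ring.
Qed.

Local Open Scope classical_set_scope.

Definition generation (R : realType) (f : R -> R) (n : nat) (v : R) : R :=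
  \sum_(1 <= k < (2 ^ n).+1)
    (Delta f n k * \1_(`](k%:R - 1) / 2 ^+ n, k%:R / 2 ^+ n[) v).

Lemma indic_itv_oo (R : realType) (a b v : R) :
  \1_(`]a, b[) v = ((a < v) && (v < b))%:R :> R.
Proof. by rewrite indicE mem_setE in_itv. Qed.

(** For [v <= 1/2] the dyadic intervals of the right half do not contain v, and
    those of the left half become the intervals of level n after doubling. *)
Lemma generation_S_left (R : realType) (f : R -> R) n (v : R) : v <= 1 / 2 ->
  generation f n.+1 v = generation (fun w => f (w / 2)) n (2 * v).
Proof.
move=> hv; rewrite /generation.
have p2 : 0 < 2 ^+ n :> R by rewrite exprn_gt0.
rewrite (big_cat_nat (n := (2 ^ n).+1)) //=; last first.
  by rewrite ltnS leq_exp2l.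
rewrite [X in _ + X]big_nat_cond [X in _ + X]big1 ?addr0; last first.
  move=> k /andP[/andP[hk _] _]; rewrite indic_itv_oo.
  have -> : ((k%:R - 1) / 2 ^+ n.+1 < v) = false; last by rewrite mulr0.
  apply/negbTE; rewrite -leNgt; apply: le_trans hv _.
  rewrite exprS ler_pdivlMr ?mulr_gt0//.
  have : (2 ^ n)%:R <= k%:R - 1 :> R by rewrite lerBrDr natr1 ler_nat.
  by rewrite natrX; lra.
apply: eq_bigr => k _; congr (_ * _).
  by rewrite /Delta !exprS !invfM; congr (f _ + f _ - 2 * f _); ring.
rewrite !indic_itv_oo; congr (_%:R).
by rewrite exprS !ltr_pdivrMr ?ltr_pdivlMr ?mulr_gt0// mulrA [v * 2]mulrC.
Qed.

Lemma generation_S_right (R : realType) (f : R -> R) n (v : R) : 1 / 2 <= v ->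
  generation f n.+1 v = generation (fun w => f ((1 + w) / 2)) n (2 * v - 1).
Proof.
move=> hv; rewrite /generation.
have p2 : 0 < 2 ^+ n :> R by rewrite exprn_gt0.
rewrite (big_cat_nat (n := (2 ^ n).+1)) //=; last first.
  by rewrite ltnS leq_exp2l.
rewrite [X in X + _]big_nat_cond [X in X + _]big1 ?add0r; last first.
  move=> k /andP[/andP[_ hk] _]; rewrite indic_itv_oo.
  have -> : (v < k%:R / 2 ^+ n.+1) = false; last by rewrite andbF mulr0.
  apply/negbTE; rewrite -leNgt; apply: le_trans hv.
  rewrite exprS ler_pdivrMr ?mulr_gt0//.
  have : k%:R <= (2 ^ n)%:R :> R by rewrite ler_nat.
  by rewrite natrX; lra.
rewrite -[X in \sum_(X <= _ < _) _]add1n big_addn.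
have -> : ((2 ^ n.+1).+1 - 2 ^ n = (2 ^ n).+1)%N.
  by rewrite expnS mul2n -addnn -addSn addnK.
apply: eq_bigr => k _; congr (_ * _).
  rewrite /Delta natrD natrX !exprS !invfM.
  by congr (f _ + f _ - 2 * f _); field; rewrite ?lt0r_neq0.
rewrite !indic_itv_oo; congr (_%:R).
rewrite natrD natrX exprS !ltr_pdivrMr ?ltr_pdivlMr ?mulr_gt0//.
by congr andb; apply/idP/idP; lra.
Qed.

(** Replacing the chord over [0,1] by the two chords that meet over 1/2
    subtracts exactly the term of generation 0.  On the half containing v, the
    further generations are those of the function rescaled from that half. *)
Lemma dyadic_refinement (R : realType) (N : nat) (f : R -> R) (v : R) :
  below_chords f -> 0 <= v <= 1 ->
  f v <= (1 - v) * f 0 + v * f 1 - \sum_(0 <= n < N) (r_ n v * generation f n v).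
Proof.
elim: N f v => [|N IHN] f v hf hv.
  rewrite big_nil subr0.
  have := hf 0 1 v; rewrite mulr0 mulr1 add0r; apply; lra.
have gen0 : r_ 0 v * generation f 0 v = r_ 0 v * (f 0 + f 1 - 2 * f (1 / 2)).
  rewrite /generation expn0 big_nat1 /Delta indic_itv_oo !expr0 expr1 !divr1.
  rewrite subrr mulr1 (_ : 2 - 1 = 1); last by ring.
  have [v0|v0] := eqVneq v 0; first by rewrite v0 /= subr0 min_l ?mul0r.
  have [v1|v1] := eqVneq v 1; first by rewrite v1 /= subrr min_r ?mul0r.
  have -> : 0 < v by rewrite lt_neqAle eq_sym v0; case/andP: hv.
  have -> : v < 1 by rewrite lt_neqAle v1; case/andP: hv.
  by rewrite mulr1.
rewrite big_nat_recl // gen0.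
have [v2|v2] := leP v (1 / 2).
  have hg : below_chords (fun w => f (w / 2)).
    move=> a b s ha hb hs; have := hf (a / 2) (b / 2) s ltac:(lra) ltac:(lra) hs.
    by congr (f _ <= _); field.
  under eq_bigr => n _ do rewrite r_S_left// generation_S_left//.
  have := IHN _ (2 * v) hg ltac:(lra).
  rewrite (_ : 2 * v / 2 = v) ?mul0r; last by field.
  have -> : r_ 0 v = v by rewrite /=; apply/min_idPl; lra.
  lra.
have {}v2 := ltW v2.
have hg : below_chords (fun w => f ((1 + w) / 2)).
  move=> a b s ha hb hs.
  have := hf ((1 + a) / 2) ((1 + b) / 2) s ltac:(lra) ltac:(lra) hs.
  by congr (f _ <= _); field.
under eq_bigr => n _ do rewrite r_S_right// generation_S_right//.
have := IHN _ (2 * v - 1) hg ltac:(lra).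
rewrite (_ : (1 + (2 * v - 1)) / 2 = v); last by field.
rewrite (_ : (1 + 1) / 2 = 1 :> R); last by field.
rewrite addr0.
have -> : r_ 0 v = 1 - v by rewrite /=; apply/min_idPr; lra.
lra.
Qed.

Lemma log_midconvex_refinement (R : realType) (f g : R -> R) (C a b : R)
    (N : nat) (v : R) :
  (forall u, 0 <= g u) -> (forall u, 0 <= u <= 1 -> g u <= C) ->
  (forall x y, g ((x + y) / 2) ^+ 2 <= g x * g y) ->
  (forall u, f u = g u * g (1 - u)) -> g 0 = a -> g 1 = b -> 0 <= v <= 1 ->
  f v <= a * b - \sum_(0 <= n < N) (r_ n v * generation f n v).
Proof.
move=> g_ge0 gC gmid fE <- <- hv.
have f_below_chords : below_chords f.
  rewrite (_ : f = fun u => g u * g (1 - u)); last exact/funext.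
  exact: log_midconvex_below_chords g_ge0 gC gmid.
have := dyadic_refinement N f_below_chords hv.
by rewrite (fE 0) (fE 1) subr0 subrr [g 1 * g 0]mulrC -mulrDl subrK mul1r.
Qed.

(** * The refined inequality *)

Theorem theorem16 (R : realType) (d : nat) (A B X : 'M[R[i]]_d)
    (nrm : 'M[R[i]]_d -> R) (N : nat) (t v : R)
    (hA : posdefmx A) (hB : posdefmx B)
    (hnrm : unitarily_invariant_norm nrm)
    (ht : 0 < t) (hv : 0 <= v <= 1) :
  let f (u : R) : R :=
    nrm (mxpowR (mxabs (mxpowR A (1 - u) *m X *m mxpowR B u)) t) *
    nrm (mxpowR (mxabs (mxpowR A u *m X *m mxpowR B (1 - u))) t) in
  is_true (
  nrm (mxpowR (mxabs (mxpowR A (1 - v) *m X *m mxpowR B v)) t) *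
  nrm (mxpowR (mxabs (mxpowR A v *m X *m mxpowR B (1 - v))) t)
  <= nrm (mxpowR (mxabs (A *m X)) t) * nrm (mxpowR (mxabs (X *m B)) t)
     - \sum_(0 <= n < N) (r_ n v *
         \sum_(1 <= k < (2 ^ n).+1)
            (Delta f n k *
             \1_(`](k%:R - 1) / 2 ^+ n, k%:R / 2 ^+ n[) v))).
Proof.
move=> f.
pose g (u : R) := nrm (mxpowR (mxabs (mxpowR A (1 - u) *m X *m mxpowR B u)) t).
have fE u : f u = g u * g (1 - u) by rewrite /f /g subKr.
have g_ge0 u : 0 <= g u by exact: (uinorm_ge0 hnrm).
have [C gC] : exists C, forall u, 0 <= u <= 1 -> g u <= C.
  apply: (uinorm_mxabs_bounded (F := fun u => mxpowR A (1 - u) *m X *m mxpowR B u) hnrm ht).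
  apply: entry_bounded_mul; last exact: (entry_bounded_mxpowR (h := id) hB).
  apply: entry_bounded_mul; last exact: entry_bounded_cst.
  by apply: (entry_bounded_mxpowR (h := fun u => 1 - u) hA); exact: onem_itv01.
have g_mid x y : g ((x + y) / 2) ^+ 2 <= g x * g y.
  exact: (uinorm_heinz_log_midconvex X x y hA hB hnrm ht).
have AX : mxpowR A (1 - 0) *m X *m mxpowR B 0 = A *m X.
  by rewrite subr0 (mxpowR1 hA) (mxpowR0 hB) mulmx1.
have XB : mxpowR A (1 - 1) *m X *m mxpowR B 1 = X *m B.
  by rewrite subrr (mxpowR0 hA) (mxpowR1 hB) mul1mx.
have g0 : g 0 = nrm (mxpowR (mxabs (A *m X)) t).
  exact: (congr1 (fun M => nrm (mxpowR (mxabs M) t)) AX).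
have g1 : g 1 = nrm (mxpowR (mxabs (X *m B)) t).
  exact: (congr1 (fun M => nrm (mxpowR (mxabs M) t)) XB).
exact: (log_midconvex_refinement N g_ge0 gC g_mid fE g0 g1 hv).
Qed.
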